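(* Let $N\in\mathbb{N}$ and let $\tilde W=(\tilde w_{i,j})=\mathbf 1\mathbf 1^{\mathrm T}$, i.e. $\tilde w_{i,j}=1$ for all $1\le i,j\le N$. Then any initial configuration $v\in(0,1)^N$ with distinct entries, evolving according to $$\partial_t v_i=\sum_{j\in J_2^i}\tilde w_{i,j}\,\Phi(v_j-v_i)-\sum_{j=1}^N\tilde w_{i,j}\,\Phi(v_j+v_i),\qquad i=1,\ldots,N,$$ converges to a unique steady state $v^*$ for $t\to\infty$. This is the global minimiser of the energy $$E(v,\tilde W)=\frac12\sum_{i=1}^N\sum_{j=1}^N\tilde w_{i,j}\Big(\Psi\big((v_j-v_i)^2\big)+\Psi\big((v_j+v_i)^2\big)\Big).$$
   Context: $J_2^i:=\{j\in\{1,\ldots,N\}\mid v_j\neq v_i\}$ (depending on the current positions). Penaliser and flux: $\Psi:\mathbb{R}_0^+\to\mathbb{R}$ is such that $s\mapsto\Psi(s^2)$ is continuously differentiable, decreasing and strictly convex on $[0,1]$, with $\Psi(0)=0$ and vanishing left-sided derivative at $s=1$. It is extended to $[-1,1]$ by symmetry (evenness) and to $\mathbb{R}$ by periodicity $\Psi((2+s)^2)=\Psi(s^2)$. The flux is $\Phi(s):=\Psi'(s^2)\,s$, i.e. half the derivative of $s\mapsto\Psi(s^2)$, defined for $s$ not an even integer. Hence $\Phi(-s)=-\Phi(s)$, $\Phi(2+s)=\Phi(s)$, $\Phi$ is continuous and increasing on $(0,2)$, $\Phi(1)=0$, and $\Phi$ has jump discontinuities at the even integers. *)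

(* Defs.v *)
From HB Require Import structures.
From mathcomp Require Import all_boot all_order all_algebra.
From mathcomp Require Import all_classical all_reals all_analysis.

Set Implicit Arguments.
Unset Strict Implicit.
Unset Printing Implicit Defensive.

Import Order.TTheory GRing.Theory Num.Theory.
Import numFieldNormedType.Exports.

Local Open Scope classical_set_scope.
Local Open Scope ring_scope.

(* One-sided at the end points when [A] is an interval. *)
Definition is_derive_within (R : realType) (A : set R) (f : R -> R) (x l : R) :
    Prop :=
  (f y - f x) / (y - x) @[y --> within A x^'] --> l.

Definition C1_within (R : realType) (A : set R) (f : R -> R) : Prop :=
  exists df : R -> R, {within A, continuous df} /\
    forall x, A x -> is_derive_within A f x (df x).

Definition decreasing_on (R : realType) (A : set R) (f : R -> R) : Prop :=
  forall x y, A x -> A y -> x < y -> f y < f x.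

Definition strictly_convex_on (R : realType) (A : set R) (f : R -> R) : Prop :=
  forall x y t, A x -> A y -> x != y -> 0 < t < 1 ->
    f (t * x + (1 - t) * y) < t * f x + (1 - t) * f y.

(* Only the values of [Psi] on nonnegative reals matter.  The extension of
   s |-> Psi (s ^ 2) from [0, 1] to [-1, 1] by evenness is automatic. *)
Record penaliser (R : realType) (Psi : R -> R) : Prop := Penaliser {
  penaliser_C1 : C1_within `[0, 1] (fun s => Psi (s ^+ 2));
  penaliser_decreasing : decreasing_on `[0, 1] (fun s => Psi (s ^+ 2));
  penaliser_convex : strictly_convex_on `[0, 1] (fun s => Psi (s ^+ 2));
  penaliser0 : Psi 0 = 0;
  penaliser_left1 :
    (Psi (s ^+ 2) - Psi (1 ^+ 2)) / (s - 1) @[s --> 1^'-] --> (0 : R);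
  penaliser_periodic : forall s : R, Psi ((2 + s) ^+ 2) = Psi (s ^+ 2)
}.

(* Meaningful only when [s] is not an even integer: elsewhere s |-> Psi (s ^ 2)
   has a kink and the value is unspecified (0 when s = 0). *)
Definition flux (R : realType) (Psi : R -> R) (s : R) : R :=
  derive1 Psi (s ^+ 2) * s.

(* The index set of the first sum is J_2^i; for [v] in (0, 1)^N the flux is
   only evaluated in (-1, 0), (0, 1) and (0, 2). *)
Definition velocity (R : realType) (N : nat) (Psi : R -> R) (W : 'M[R]_N)
    (v : 'rV[R]_N) (i : 'I_N) : R :=
  \sum_(j | v 0 j != v 0 i) W i j * flux Psi (v 0 j - v 0 i)
  - \sum_j W i j * flux Psi (v 0 j + v 0 i).

Definition energy (R : realType) (N : nat) (Psi : R -> R) (W : 'M[R]_N)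
    (v : 'rV[R]_N) : R :=
  2^-1 * \sum_i \sum_j
    W i j * (Psi ((v 0 j - v 0 i) ^+ 2) + Psi ((v 0 j + v 0 i) ^+ 2)).

Definition admissible (R : realType) (N : nat) (v : 'rV[R]_N) : Prop :=
  (forall i, 0 < v 0 i < 1) /\ injective (fun i => v 0 i).

Definition same_order (R : realType) (N : nat) (v w : 'rV[R]_N) : Prop :=
  forall i j, (v 0 i < v 0 j) = (w 0 i < w 0 j).

Definition steady_state (R : realType) (N : nat) (Psi : R -> R) (W : 'M[R]_N)
    (v : 'rV[R]_N) : Prop :=
  forall i, velocity Psi W v i = 0.

Definition evolution (R : realType) (N : nat) (Psi : R -> R) (W : 'M[R]_N)
    (v0 : 'rV[R]_N) (v : R -> 'rV[R]_N) : Prop :=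
  [/\ v 0 = v0,
      {within `[0, +oo[, continuous v} &
      forall (t : R) (i : 'I_N), 0 < t ->
        is_derive t 1 (fun s : R => v s 0 i) (velocity Psi W (v t) i)].

Definition global_minimiser (R : realType) (N : nat) (E : 'rV[R]_N -> R)
    (v : 'rV[R]_N) : Prop :=
  forall w, E v <= E w.

(* Main.v *)
(* Adding to the particles v_i their mirror images -v_i turns the system into
   2N particles on the circle R / 2Z, any two of which repel each other with
   the decreasing force -Phi. As long as the initial order persists, the
   velocity is a sum of continuous monotone pair forces, and a negative
   multiple of the gradient of the energy, which is strictly convex on the
   closed set of configurations in that order. At a collision the pair
   involved is pushed apart because Phi(0+) < 0, so the order does persist.
   The equidistributed configuration is balanced by symmetry, hence by
   convexity it is the only minimiser in its order, and, as every point of R^N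
   can be folded into [0, 1]^N and permuted into that order without changing
   the energy, it is a global minimiser. Monotonicity of the forces makes the
   squared distance to it a strict Lyapunov function. *)
Require Import Defs.
From HB Require Import structures.
From mathcomp Require Import all_boot all_order all_algebra.
From mathcomp Require Import all_classical all_reals all_analysis.
From mathcomp Require Import fingroup perm ring lra zify.

Set Implicit Arguments.
Unset Strict Implicit.
Unset Printing Implicit Defensive.

Import Order.TTheory GRing.Theory Num.Theory.
Import numFieldNormedType.Exports.

Local Open Scope classical_set_scope.
Local Open Scope ring_scope.

(** * Calculus on intervals and tangents of convex functions *)

(** All values of [r] lie in [A], so neighbourhoods within [A] suffice. With a clamping map for [r],
    a function controlled only on an interval becomes continuous on the whole line. *)
Lemma continuous_retract (T U : topologicalType) (A : set T) (f : T -> U)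
    (r : T -> T) :
  {within A, continuous f} -> continuous r -> (forall x, A (r x)) ->
  continuous (f \o r).
Proof.
move=> fA rc Ar x; apply: (@cvg_comp _ _ _ r f); last exact: fA.
rewrite /nbhs/= -nbhs_subspace_in; last exact: Ar.
move=> P Px; have {}Px : nbhs (r x) (fun z => A z -> P z) := Px.
have nearP : \forall y \near x, A (r y) -> P (r y) := rc x _ Px.
by change (nbhs x (P \o r)); apply: filterS nearP => y; apply.
Qed.

Lemma dnbhs_shift (R : realType) (s : R) : h + s @[h --> 0^'] --> s^'.
Proof.
move=> P Ps; have {}Ps : nbhs s (fun y => y != s -> P y) := Ps.
change (nbhs (0 : R) (fun h => h != 0 -> P (h + s))).
have : h + s @[h --> (0:R)] --> s.
  rewrite -[X in _ --> X]add0r; apply: cvgD; [exact: cvg_id|exact: cvg_cst].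
move=> /(_ _ Ps) near0.
have {}near0 : \forall h \near (0 : R), h + s != s -> P (h + s) := near0.
apply: filterS near0 => h /= Ph h0; apply: Ph.
by rewrite -subr_eq0 addrK.
Qed.

Lemma is_derive_slope (R : realType) (f : R -> R) (s l : R) :
  (f y - f s) / (y - s) @[y --> s^'] --> l -> is_derive s 1 f l.
Proof.
move=> fl.
have dl : h^-1 *: ((f \o shift s) (h *: 1) - f s) @[h --> 0^'] --> l.
  have -> : (fun h : R => h^-1 *: ((f \o shift s) (h *: 1) - f s)) =
            (fun y => (f y - f s) / (y - s)) \o (fun h => h + s).
    apply/funext => h /=.
    by rewrite [h%:A](mulr1) addrK [_ *: _]mulrC.
  exact: (cvg_comp _ _ (@dnbhs_shift R s) fl).
apply: DeriveDef; [exact: cvgP dl | exact: cvg_lim dl].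
Qed.

Lemma is_derive_within_interior (R : realType) (a b s l : R) (f : R -> R) :
  a < s < b -> is_derive_within `[a, b] f s l -> is_derive s 1 f l.
Proof.
move=> sab fl; apply: is_derive_slope; apply: cvg_trans fl.
apply: cvg_app => P PA.
have {}PA : s^' (fun y => y \in `[a, b] -> P y) := PA.
have : \forall y \near s, y \in `]a, b[ by apply: near_in_itvoo.
move=> /(@nbhs_dnbhs R s) nears; apply: filterS2 PA nears => y Py yab.
apply: Py.
by move: yab; rewrite !in_itv/= => /andP[/ltW-> /ltW->].
Qed.

(** Along the segment from [x] to a point [z] the graph stays below the chord; in the limit at [x]
    the tangent lies weakly below [f z]. Taking for [z] the midpoint of [x] and [y], where [f] is
    strictly below the chord, makes the inequality at [y] strict. *)
Lemma strictly_convex_tangent (R : realType) (a b : R) (f : R -> R)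
    (x y l : R) :
  strictly_convex_on `[a, b] f -> is_derive_within `[a, b] f x l ->
  x \in `[a, b] -> y \in `[a, b] -> y != x -> f x + l * (y - x) < f y.
Proof.
move=> fcvx fl xab yab yx.
have conv t z w : z \in `[a, b] -> w \in `[a, b] -> 0 < t < 1 ->
    t * z + (1 - t) * w \in `[a, b].
  rewrite !in_itv/= => /andP[? ?] /andP[? ?] /andP[? ?].
  by apply/andP; split; nra.
have weak z : z \in `[a, b] -> z != x -> f x + l * (z - x) <= f z.
  move=> zab zx.
  have t01 : \forall t \near (0:R)^'+, 0 < t < 1.
    near=> t; apply/andP; split; near: t; first exact: nbhs_right_gt.
    by apply: nbhs_right_lt; rewrite ltr01.
  (* Moving along the segment never leaves the interval, so [x] may be an end point. *)
  have ray : t * z + (1 - t) * x @[t --> 0^'+] --> within `[a, b] x^'.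
    move=> P Px.
    have {}Px : nbhs x (fun y => y != x -> y \in `[a, b] -> P y) := Px.
    have : t * z + (1 - t) * x @[t --> (0:R)^'+] --> x.
      have {2}-> : x = 0 * z + (1 - 0) * x by rewrite mul0r add0r subr0 mul1r.
      apply: cvg_at_right_filter.
      apply: cvgD; apply: cvgM; try exact: cvg_cst; first exact: cvg_id.
      by apply: cvgB; [exact: cvg_cst|exact: cvg_id].
    move=> /(_ _ Px) near0.
    have {}near0 : \forall t \near (0 : R)^'+, t * z + (1 - t) * x != x ->
      t * z + (1 - t) * x \in `[a, b] -> P (t * z + (1 - t) * x) := near0.
    apply: filterS2 near0 t01 => t + t01 /=.
    apply; last exact: conv.
    have [t0 _] := andP t01.
    rewrite -subr_eq0 (_ : _ - x = t * (z - x)); last by ring.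
    by rewrite mulf_neq0 ?subr_eq0// gt_eqF.
  have slope : (f (t * z + (1 - t) * x) - f x) / (t * z + (1 - t) * x - x) *
      (z - x) @[t --> 0^'+] --> l * (z - x).
    by apply: cvgM (cvg_cst _); exact: (cvg_comp _ _ ray fl).
  rewrite addrC -lerBrDr; apply: (cvgr_to_le slope); near=> t.
  have t01' : 0 < t < 1 by near: t.
  have [t0 _] := andP t01'.
  have -> : t * z + (1 - t) * x - x = t * (z - x) by ring.
  rewrite invfM mulrA -mulrA mulVf ?subr_eq0// mulr1 ler_pdivrMr//.
  have := fcvx z x t zab xab zx t01'.
  by move=> /ltW H'; rewrite lerBlDr (le_trans H')//; lra.
have h01 : 0 < (2^-1 : R) < 1 by lra.
have mab := conv _ _ _ yab xab h01.
have := fcvx y x 2^-1 yab xab yx h01.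
have mx : 2^-1 * y + (1 - 2^-1) * x != x.
  by apply/eqP => E; move/eqP: yx; apply; lra.
have := weak _ mab mx; lra.
Unshelve. all: by end_near. Qed.

(** * The flux as a continuous monotone function *)

(* [G] is the flux on (0, 2) continued by its one-sided limits at 0 and 2, and
   by constants beyond, so that it is continuous and monotone on the whole
   line. *)
Record flux_extension (R : realType) (Psi G : R -> R) : Prop := FluxExtension {
  flux_ext_continuous : continuous G;
  flux_ext_reflect : forall s, G (2 - s) = - G s;
  flux_ext_homo : {homo G : x y / x <= y};
  flux_extE : forall s, 0 < s < 2 -> flux Psi s = G s;
  flux_ext_tangent : forall x y, x \in `[0, 2] -> y \in `[0, 2] -> y != x ->
    Psi (x ^+ 2) + 2 * G x * (y - x) < Psi (y ^+ 2)
}.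

Lemma penaliser_reflect (R : realType) (Psi : R -> R) (s : R) :
  penaliser Psi -> Psi ((2 - s) ^+ 2) = Psi (s ^+ 2).
Proof. by move=> hPsi; rewrite (penaliser_periodic hPsi) sqrrN. Qed.

(** Near [s ^+ 2] the function [Psi] is s |-> Psi (s ^ 2) composed with the square root, so the
    chain rule gives [derive1 Psi]. The factor 2 reflects that the flux is half a derivative. *)
Lemma flux_derive (R : realType) (Psi : R -> R) (s l : R) :
  0 < s -> is_derive s 1 (fun y => Psi (y ^+ 2)) (2 * l) -> flux Psi s = l.
Proof.
move=> s0 fl.
have s20 : 0 < s ^+ 2 by rewrite exprn_gt0.
have sq : Num.sqrt (s ^+ 2) = s by rewrite sqrtr_sqr gtr0_norm.
have fl' : is_derive (Num.sqrt (s ^+ 2)) 1 (fun y => Psi (y ^+ 2)) (2 * l).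
  by rewrite sq.
have := is_derive1_comp fl' (is_derive1_sqrt s20).
rewrite sq => comp.
have : is_derive (s ^+ 2) 1 Psi (2 * l * (2 * s)^-1).
  apply: near_eq_is_derive comp; near=> u => /=.
  by rewrite sqr_sqrtr// ltW//; near: u; exact: lt_nbhsr.
move=> [_ D]; rewrite /flux derive1E D; field; exact: lt0r_neq0.
Unshelve. all: by end_near. Qed.

Lemma cvg_reflect_right (R : realType) (a : R) :
  2 * a - y @[y --> a^'+] --> a^'-.
Proof.
move=> P Pa; have {}Pa : nbhs a (fun y => y < a -> P y) := Pa.
have : 2 * a - y @[y --> a] --> a.
  rewrite [X in _ --> X](_ : a = 2 * a - a); last by ring.
  apply: cvgB; [exact: cvg_cst|exact: cvg_id].
move=> /(_ _ Pa) neara.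
have {}neara : \forall y \near a, 2 * a - y < a -> P (2 * a - y) := neara.
change (nbhs a (fun y => a < y -> P (2 * a - y))).
by apply: filterS neara => y + ay; apply; lra.
Qed.

Lemma is_derive_reflect (R : realType) (f : R -> R) (s l : R) :
  (forall y, f (2 - y) = f y) -> is_derive (2 - s) 1 f l ->
  is_derive s 1 f (- l).
Proof.
move=> fr fl.
have d2 : is_derive s 1 (fun y : R => 2 - y) (-1).
  rewrite -[X in is_derive _ _ _ X]add0r; apply: is_deriveB.
have := @is_derive1_comp _ f (fun y => 2 - y) _ _ _ fl d2; rewrite mulrN1.
by have -> : f \o (fun y => 2 - y) = f by apply/funext => y /=.
Qed.

Lemma penaliser_flux_extension (R : realType) (Psi : R -> R) :
  penaliser Psi -> exists G, flux_extension Psi G.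
Proof.
move=> hPsi; set f := fun s : R => Psi (s ^+ 2).
have frefl s : f (2 - s) = f s by exact: penaliser_reflect.
have [df [df_cont df_der]] := penaliser_C1 hPsi.
have i1 : (1 : R) \in `[0, 1] by rewrite in_itv/= ler01 lexx.
(* Within [0, 1] the derivative at 1 is the left-sided one, which vanishes by assumption. *)
have df1 : df 1 = 0.
  have left_within : ((1:R)^'- --> within `[0, 1] (1:R)^').
    move=> P P1.
    have {}P1 : nbhs (1:R) (fun y => y != 1 -> y \in `[0, 1] -> P y) := P1.
    change (nbhs (1:R) (fun y => y < 1 -> P y)).
    have pos : \forall y \near (1:R), 0 < y by apply: lt_nbhsr; exact: ltr01.
    apply: filterS2 P1 pos => y Py y0 y1; apply: Py; first by rewrite lt_eqF.
    by rewrite in_itv/= !ltW.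
  have left_df : (f s - f 1) / (s - 1) @[s --> 1^'-] --> df 1.
    exact: (cvg_comp _ _ left_within (df_der 1 i1)).
  rewrite -(cvg_lim _ left_df)//.
  by apply: cvg_lim => //; exact: penaliser_left1.
have tangent01 (x y : R) : x \in `[0, 1] -> y \in `[0, 1] -> y != x ->
    f x + df x * (y - x) < f y.
  move=> xi yi yx.
  exact: (strictly_convex_tangent (penaliser_convex hPsi) (df_der x xi)).
have df_incr (x y : R) : x \in `[0, 1] -> y \in `[0, 1] -> x <= y ->
    df x <= df y.
  move=> xi yi; rewrite le_eqVlt => /orP[/eqP->//|xy].
  have := tangent01 x y xi yi; rewrite gt_eqF// => /(_ isT).
  have := tangent01 y x yi xi; rewrite lt_eqF// => /(_ isT).
  by move=> ? ?; rewrite leNgt; apply/negP => ?; nra.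
pose clamp (s : R) := Num.max 0 (Num.min s 1).
have clamp01 s : clamp s \in `[0, 1].
  by rewrite in_itv/= le_max lexx/= ge_max ler01 ge_min lexx orbT.
have clampE (s : R) : s \in `[0, 1] -> clamp s = s.
  rewrite in_itv/= => /andP[s0 s1].
  by rewrite /clamp (min_idPl s1) (max_idPr s0).
have clamp1 s : 1 <= s -> clamp s = 1.
  by move=> s1; rewrite /clamp (min_idPr s1) (max_idPr _)// ler01.
have clamp_homo : {homo clamp : x y / x <= y}.
  move=> x y xy; rewrite /clamp ge_max !le_max lexx/=.
  by rewrite le_min !ge_min lexx xy /= !orbT.
have clamp_cont : continuous clamp.
  move=> s; apply: (@max_fun_continuous _ R R (cst 0) (fun s => Num.min s 1)).
    by move=> ?; exact: cvg_cst.
  by move=> ?; apply: (@min_fun_continuous _ R R id (cst 1)) => ?;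
    [exact: cvg_id|exact: cvg_cst].
pose g s := df (clamp s).
have g_cont : continuous g.
  exact: continuous_retract df_cont clamp_cont clamp01.
have g_homo : {homo g : x y / x <= y}.
  by move=> x y xy; apply: df_incr => //; exact: clamp_homo.
(* At every [s] one of [s] and [2 - s] is at least 1 and clamps to 1, where [df] vanishes. So only
   one term is active on each side of 1, and the reflection law holds by construction. *)
pose G s := (g s - g (2 - s)) / 2.
have G_refl s : G (2 - s) = - G s.
  by rewrite /G subKr; field.
have GE (s : R) : s \in `[0, 1] -> 2 * G s = df s.
  move=> si; have := si; rewrite in_itv/= => /andP[s0 s1].
  rewrite /G /g clampE// clamp1; last by lra.
  by rewrite df1; field.
have G_der (s : R) : 0 < s < 2 -> is_derive s 1 f (2 * G s).
  move=> s02; have [s1|s1|s1] := ltgtP s 1.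
  - rewrite GE; last by rewrite in_itv/=; lra.
    apply: (@is_derive_within_interior _ 0 1); first lra.
    by apply: df_der; rewrite /= in_itv/=; lra.
  - rewrite -[2 * G s]opprK -mulrN -G_refl; apply: is_derive_reflect => //.
    rewrite GE; last by rewrite in_itv/=; lra.
    apply: (@is_derive_within_interior _ 0 1); first lra.
    by apply: df_der; rewrite /= in_itv/=; lra.
  - rewrite s1 GE// df1; apply: is_derive_slope.
    have left1 : (f y - f 1) / (y - 1) @[y --> 1^'-] --> 0.
      exact: penaliser_left1.
    apply: (@cvg_at_right_left_dnbhs _ R^o) => //.
    have -> : (fun y => (f y - f 1) / (y - 1)) =
        (fun y => - ((f (2 * 1 - y) - f 1) / (2 * 1 - y - 1))).
      apply/funext => y; rewrite mulr1 frefl -mulrN -invrN; congr (_ / _); ring.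
    rewrite -oppr0; apply: cvgN.
    exact: (cvg_comp _ _ (@cvg_reflect_right R 1) left1).
have tangent (x y : R) : x \in `[0, 1] -> y \in `[0, 2] -> y != x ->
    f x + 2 * G x * (y - x) < f y.
  move=> xi; rewrite GE// in_itv/= => /andP[y0 y2] yx.
  have [y1|y1] := leP y 1; first by apply: tangent01; rewrite // in_itv/= y0.
  (* For [y] beyond 1, [f y = f (2 - y)] exceeds [f 1]. The tangent at [x] has slope at most 0 and
     is already below [f 1] at the point 1. *)
  have dfx := df_incr x 1 xi i1; have := xi; rewrite in_itv/= => /andP[x0 x1].
  have yi : 2 - y \in `[0, 1] by rewrite in_itv/=; lra.
  have := tangent01 1 _ i1 yi; rewrite df1 frefl lt_eqF; last by lra.
  move=> /(_ isT); rewrite mul0r addr0 => f1y.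
  have f1x : f x + df x * (1 - x) <= f 1.
    have [->|xn1] := eqVneq x 1; first by rewrite subrr mulr0 addr0.
    by apply/ltW/tangent01 => //; rewrite eq_sym.
  have := dfx x1; rewrite df1; nra.
exists G; split.
- move=> s; apply: cvgM; last exact: cvg_cst.
  apply: cvgB; first exact: g_cont.
  apply: (@cvg_comp _ _ _ (fun s => 2 - s) g); last exact: g_cont.
  by apply: cvgB; [exact: cvg_cst|exact: cvg_id].
- exact: G_refl.
- move=> x y xy; rewrite /G ler_pM2r ?invr_gt0// lerB// g_homo//.
  by rewrite lerB.
- move=> s s02; apply: flux_derive; first by case/andP: s02.
  exact: G_der.
- move=> x y xi yi yx; rewrite -!/(f _).
  have := xi; rewrite in_itv/= => /andP[x0 x2].
  have := yi; rewrite in_itv/= => /andP[y0 y2].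
  have [x1|x1] := leP x 1; first by apply: tangent => //; rewrite in_itv/= x0.
  rewrite -(frefl x) -(frefl y).
  have -> : 2 * G x * (y - x) = 2 * G (2 - x) * ((2 - y) - (2 - x)).
    by rewrite G_refl; ring.
  by apply: tangent; rewrite ?in_itv/=; lra.
Qed.

Lemma flux_ext_mono (R : realType) (Psi G : R -> R) (x y : R) :
  flux_extension Psi G -> 0 <= (G x - G y) * (x - y).
Proof.
move=> hG; have [xy|/ltW xy] := leP x y; have := flux_ext_homo hG xy; nra.
Qed.

(** The strict tangent inequalities at [x] and at [y] add up to [0 < (G y - G x) * (y - x)]. *)
Lemma flux_ext_lt (R : realType) (Psi G : R -> R) (x y : R) :
  flux_extension Psi G -> x \in `[0, 2] -> y \in `[0, 2] -> x < y -> G x < G y.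
Proof.
move=> hG xi yi xy.
have := flux_ext_tangent hG xi yi; rewrite gt_eqF// => /(_ isT).
have := flux_ext_tangent hG yi xi; rewrite lt_eqF// => /(_ isT).
by move=> ? ?; rewrite ltNge; apply/negP => ?; nra.
Qed.

Lemma flux_ext_tangent_le (R : realType) (Psi G : R -> R) (x y : R) :
  flux_extension Psi G -> x \in `[0, 2] -> y \in `[0, 2] ->
  Psi (x ^+ 2) + 2 * G x * (y - x) <= Psi (y ^+ 2).
Proof.
move=> hG xi yi; have [->|yx] := eqVneq y x; first by rewrite subrr mulr0 addr0.
exact/ltW/(flux_ext_tangent hG).
Qed.

(** Repulsion does not fade at contact: [G 0 < G 2 = - G 0]. *)
Lemma flux_ext0_lt0 (R : realType) (Psi G : R -> R) :
  flux_extension Psi G -> G 0 < 0.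
Proof.
move=> hG; have /(flux_ext_lt hG) : (0 : R) < 2 by [].
rewrite !in_itv/= !lexx ler0n => /(_ isT isT).
by have := flux_ext_reflect hG 0; rewrite subr0 => ->; lra.
Qed.

(** * The velocity in a fixed order and its monotonicity *)

(* The velocity for the order of the particles frozen to that of [v0].  Unlike
   [velocity] it is continuous in [x], up to and including collisions. *)
Definition ordered_velocity (R : realType) (N : nat) (G : R -> R)
    (v0 x : 'rV[R]_N) (i : 'I_N) : R :=
  \sum_(j | v0 0 i < v0 0 j) G (x 0 j - x 0 i)
  - \sum_(j | v0 0 j < v0 0 i) G (x 0 i - x 0 j)
  - \sum_j G (x 0 j + x 0 i).

(** Oddness of the flux brings every argument into (0, 2), where [G] agrees with it. *)
Lemma velocity_ordered (R : realType) (N : nat) (Psi G : R -> R)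
    (v0 w : 'rV[R]_N) (i : 'I_N) :
  flux_extension Psi G -> admissible w -> same_order v0 w ->
  velocity Psi (const_mx 1) w i = ordered_velocity G v0 w i.
Proof.
move=> hG [w01 _] ord; rewrite /velocity /ordered_velocity.
congr (_ - _); last first.
  apply: eq_bigr => j _; rewrite mxE mul1r (flux_extE hG)//.
  by have := w01 i; have := w01 j; lra.
rewrite (bigID (fun j => w 0 i < w 0 j))/=; congr (_ + _).
  apply: eq_big => [j|j /andP[_ ij]].
    by rewrite ord; have [] := ltgtP (w 0 i) (w 0 j).
  rewrite mxE mul1r (flux_extE hG)//.
  by have := w01 i; have := w01 j; lra.
rewrite -sumrN; apply: eq_big => [j|j /andP[ne nij]].
  by rewrite ord; have [] := ltgtP (w 0 i) (w 0 j).
rewrite mxE mul1r -(flux_extE hG).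
  by rewrite /flux -mulrN opprB -[X in _ (X ^+ 2)]opprB sqrrN.
have : w 0 j < w 0 i by rewrite lt_neqAle ne leNgt.
by have := w01 i; have := w01 j; lra.
Qed.

(** Summation by parts: the forces are collected pair by pair. Formally the sum is minus half the
    derivative of the energy at [x] in the direction [y]. *)
Lemma sum_ordered_velocity (R : realType) (N : nat) (G : R -> R)
    (v0 x y : 'rV[R]_N) :
  \sum_i y 0 i * ordered_velocity G v0 x i =
  - (\sum_i \sum_(j | v0 0 i < v0 0 j) G (x 0 j - x 0 i) * (y 0 j - y 0 i))
  - 2^-1 * (\sum_i \sum_j G (x 0 j + x 0 i) * (y 0 j + y 0 i)).
Proof.
under eq_bigr do rewrite /ordered_velocity !mulrBr.
rewrite !big_split/= !sumrN; congr (_ - _).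
  have -> : \sum_i y 0 i * (\sum_(j | v0 0 j < v0 0 i) G (x 0 i - x 0 j)) =
      \sum_i \sum_(j | v0 0 i < v0 0 j) G (x 0 j - x 0 i) * y 0 j.
    under eq_bigr do rewrite mulr_sumr.
    rewrite (exchange_big_dep predT)//=.
    by apply: eq_bigr => i _; apply: eq_bigr => j _; rewrite mulrC.
  rewrite -opprB; congr (- _); rewrite -sumrB; apply: eq_bigr => i _.
  rewrite mulr_sumr -sumrB; apply: eq_bigr => j _; ring.
set S := \sum_i y 0 i * _.
have -> : \sum_i \sum_j G (x 0 j + x 0 i) * (y 0 j + y 0 i) = S + S.
  have Sr : S = \sum_i \sum_j y 0 i * G (x 0 j + x 0 i).
    by apply: eq_bigr => i _; rewrite mulr_sumr.
  rewrite {1}Sr [X in _ = X + _]exchange_big Sr -big_split/=.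
  apply: eq_bigr => i _; rewrite -big_split/=; apply: eq_bigr => j _.
  by rewrite [x 0 i + _]addrC; ring.
lra.
Qed.

(** After summation by parts with [y = x - z] every pair contributes a term (G a - G b) (a - b),
    which is nonnegative. All are discarded except that of particle [k] and its own mirror image,
    which measures the dissipation. *)
Lemma ordered_velocity_monotone (R : realType) (N : nat) (Psi G : R -> R)
    (v0 x z : 'rV[R]_N) (k : 'I_N) :
  flux_extension Psi G ->
  \sum_i (x 0 i - z 0 i) *
    (ordered_velocity G v0 x i - ordered_velocity G v0 z i)
  <= - ((G (2 * x 0 k) - G (2 * z 0 k)) * (x 0 k - z 0 k)).
Proof.
move=> hG; pose y : 'rV[R]_N := x - z.
have yE i : x 0 i - z 0 i = y 0 i by rewrite !mxE.
have -> : \sum_i (x 0 i - z 0 i) *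
    (ordered_velocity G v0 x i - ordered_velocity G v0 z i) =
    \sum_i y 0 i * ordered_velocity G v0 x i
    - \sum_i y 0 i * ordered_velocity G v0 z i.
  by rewrite -sumrB; apply: eq_bigr => i _; rewrite yE mulrBr.
rewrite !sum_ordered_velocity.
set A := \sum_i _; set B := \sum_i _; set A' := \sum_i _; set B' := \sum_i _.
have AA' : 0 <= A - A'.
  rewrite /A /A' -sumrB; apply: sumr_ge0 => i _.
  rewrite -sumrB; apply: sumr_ge0 => j _; rewrite -mulrBl -!yE.
  rewrite (_ : _ - _ - _ = (x 0 j - x 0 i) - (z 0 j - z 0 i)); last by ring.
  exact: flux_ext_mono hG.
have term i j : 0 <= (G (x 0 j + x 0 i) - G (z 0 j + z 0 i)) * (y 0 j + y 0 i).
  rewrite -!yE (_ : _ - _ + _ = (x 0 j + x 0 i) - (z 0 j + z 0 i));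
    last by ring.
  exact: flux_ext_mono hG.
have BB' : 2 * ((G (2 * x 0 k) - G (2 * z 0 k)) * (x 0 k - z 0 k)) <= B - B'.
  have rowE i : \sum_j G (x 0 j + x 0 i) * (y 0 j + y 0 i) -
      \sum_j G (z 0 j + z 0 i) * (y 0 j + y 0 i) =
      \sum_j (G (x 0 j + x 0 i) - G (z 0 j + z 0 i)) * (y 0 j + y 0 i).
    by rewrite -sumrB; apply: eq_bigr => j _; rewrite mulrBl.
  rewrite /B /B' -sumrB (bigD1 k)//= rowE (bigD1 k)//= -addrA yE.
  rewrite !mulr_natl !mulr2n mulrDr lerDl; apply: addr_ge0.
    by apply: sumr_ge0 => j _; exact: term.
  by apply: sumr_ge0 => i _; rewrite rowE; apply: sumr_ge0 => j _; exact: term.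
lra.
Qed.

(** * Strict convexity of the energy in a fixed order *)

(** For injective [v0] this is the closure of the admissible configurations in the order of [v0]:
    collisions and the end points 0 and 1 are allowed. *)
Definition weakly_ordered (R : realType) (N : nat) (v0 w : 'rV[R]_N) : Prop :=
  (forall i, 0 <= w 0 i <= 1) /\
  (forall i j, v0 0 i < v0 0 j -> w 0 i <= w 0 j).

Lemma admissible_weakly_ordered (R : realType) (N : nat) (v0 w : 'rV[R]_N) :
  admissible w -> same_order v0 w -> weakly_ordered v0 w.
Proof.
move=> [w01 _] ord; split=> [i|i j]; first by have := w01 i; lra.
by rewrite ord => /ltW.
Qed.

Lemma energy_ordered (R : realType) (N : nat) (Psi : R -> R)
    (v0 w : 'rV[R]_N) :
  Psi 0 = 0 -> injective (fun i => v0 0 i) ->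
  energy Psi (const_mx 1) w =
  \sum_i \sum_(j | v0 0 i < v0 0 j) Psi ((w 0 j - w 0 i) ^+ 2)
  + 2^-1 * \sum_i \sum_j Psi ((w 0 j + w 0 i) ^+ 2).
Proof.
move=> Psi0 v0inj; rewrite /energy.
have -> : \sum_i \sum_j (const_mx 1 : 'M[R]_N) i j *
    (Psi ((w 0 j - w 0 i) ^+ 2) + Psi ((w 0 j + w 0 i) ^+ 2)) =
    \sum_i \sum_j Psi ((w 0 j - w 0 i) ^+ 2)
    + \sum_i \sum_j Psi ((w 0 j + w 0 i) ^+ 2).
  rewrite -big_split; apply: eq_bigr => i _ /=.
  by rewrite -big_split; apply: eq_bigr => j _ /=; rewrite mxE mul1r.
rewrite mulrDr; congr (_ + _); set S := RHS.
have -> : \sum_i \sum_j Psi ((w 0 j - w 0 i) ^+ 2) = S + S.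
  have ST : S = \sum_i \sum_(j | v0 0 j < v0 0 i) Psi ((w 0 i - w 0 j) ^+ 2).
    by rewrite /S (exchange_big_dep predT).
  rewrite {2}ST {1}/S -big_split/=.
  apply: eq_bigr => i _; rewrite (bigID (fun j => v0 0 i < v0 0 j))/=.
  congr (_ + _); rewrite (bigD1 i)/= ?ltxx// subrr expr0n/= Psi0 add0r.
  apply: eq_big => [j|j _]; last by rewrite -opprB sqrrN.
  have [->|ji] := eqVneq j i; first by rewrite ltxx andbF.
  rewrite andbT -leNgt [RHS]lt_neqAle; case: eqVneq => // /v0inj E.
  by rewrite E eqxx in ji.
lra.
Qed.

(** The tangent inequalities at [z] are summed over all pairs; the first-order terms cancel because
    [z] is balanced. Strictness comes from a particle [k] that differs and its own mirror image:
    differences of positions alone would not detect a common shift. *)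
Lemma energy_lt (R : realType) (N : nat) (Psi G : R -> R)
    (v0 z w : 'rV[R]_N) :
  flux_extension Psi G -> Psi 0 = 0 -> injective (fun i => v0 0 i) ->
  weakly_ordered v0 z -> weakly_ordered v0 w ->
  (forall i, ordered_velocity G v0 z i = 0) -> w != z ->
  energy Psi (const_mx 1) z < energy Psi (const_mx 1) w.
Proof.
move=> hG Psi0 v0inj [z01 zord] [w01 word] z0 wz.
have [k wzk] : exists k, w 0 k != z 0 k.
  apply/existsP; apply: contraNT wz; rewrite negb_exists => /forallP H.
  by apply/eqP/rowP => i; apply/eqP; have := H i; rewrite negbK.
have := sum_ordered_velocity G v0 z (w - z).
rewrite big1 => [|i _]; last by rewrite z0 mulr0.
rewrite !(energy_ordered _ Psi0 v0inj).
set A := \sum_i _; set B := \sum_i _; set C := \sum_i _; set D := \sum_i _.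
set A' := \sum_i _; set B' := \sum_i _ => AB.
have AA' : C + 2 * A <= A'.
  rewrite /C /A /A' mulr_sumr -big_split/=; apply: ler_sum => i _.
  rewrite mulr_sumr -big_split/=; apply: ler_sum => j ij.
  rewrite !mxE (_ : _ - _ - _ = (w 0 j - w 0 i) - (z 0 j - z 0 i));
    last by ring.
  rewrite mulrA; apply: (flux_ext_tangent_le hG); rewrite in_itv/=.
  - by have := zord _ _ ij; have := z01 i; have := z01 j; lra.
  - by have := word _ _ ij; have := w01 i; have := w01 j; lra.
have sum02 u i j : (forall i, 0 <= u 0 i <= 1) ->
    u 0 j + u 0 i \in `[0, (2 : R)].
  by move=> u01; have := u01 i; have := u01 j; rewrite in_itv/=; lra.
have termE i j : (w - z) 0 j + (w - z) 0 i =
    (w 0 j + w 0 i) - (z 0 j + z 0 i) by rewrite !mxE; ring.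
have BB' : D + 2 * B < B'.
  rewrite /D /B /B' mulr_sumr -big_split/=.
  have row_le i : \sum_j Psi ((z 0 j + z 0 i) ^+ 2) +
      2 * (\sum_j G (z 0 j + z 0 i) * ((w - z) 0 j + (w - z) 0 i)) <=
      \sum_j Psi ((w 0 j + w 0 i) ^+ 2).
    rewrite mulr_sumr -big_split/=; apply: ler_sum => j _.
    by rewrite termE mulrA; apply: (flux_ext_tangent_le hG); exact: sum02.
  rewrite (bigD1 k)//= [ltRHS](bigD1 k)//=; apply: ltr_leD; last exact: ler_sum.
  rewrite mulr_sumr -big_split/= (bigD1 k)//= [ltRHS](bigD1 k)//=.
  apply: ltr_leD.
    rewrite termE mulrA; apply: (flux_ext_tangent hG); try exact: sum02.
    by apply: contra wzk => /eqP ?; apply/eqP; lra.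
  apply: ler_sum => j _.
  by rewrite termE mulrA; apply: (flux_ext_tangent_le hG); exact: sum02.
lra.
Qed.

(** * Ranks and the balance of the equidistributed configuration *)

Definition rank (R : realType) (N : nat) (v : 'rV[R]_N) (i : 'I_N) : nat :=
  #|[pred j | v 0 j < v 0 i]|.

Lemma rank_lt (R : realType) (N : nat) (v : 'rV[R]_N) (i j : 'I_N) :
  (rank v i < rank v j)%N = (v 0 i < v 0 j).
Proof.
have mono k l : v 0 k <= v 0 l -> (rank v k <= rank v l)%N.
  move=> kl; apply/subset_leq_card/fintype.subsetP => m; rewrite !inE => mk.
  exact: lt_le_trans mk kl.
have [ij|ij] := ltP (v 0 i) (v 0 j); last by rewrite ltnNge mono.
apply: proper_card; apply/properP; split.
  by apply/fintype.subsetP => m; rewrite !inE => /lt_trans; apply.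
by exists i; rewrite inE// ltxx.
Qed.

Lemma rank_ltN (R : realType) (N : nat) (v : 'rV[R]_N) (i : 'I_N) :
  (rank v i < N)%N.
Proof.
rewrite -[X in (_ < X)%N]card_ord; apply: proper_card.
by apply/properP; split; [exact: subset_predT|exists i; rewrite ?inE// ltxx].
Qed.

(** Distinct entries make the rank a bijection onto the numbers below [N]. *)
Lemma sum_rank (R : realType) (N : nat) (v : 'rV[R]_N) (P : pred nat)
    (F : nat -> R) :
  injective (fun i => v 0 i) ->
  \sum_(i | P (rank v i)) F (rank v i) = \sum_(0 <= k < N | P k) F k.
Proof.
move=> vinj; rewrite big_mkord.
rewrite [RHS](reindex (fun i => Ordinal (rank_ltN v i)))//=.
apply: onW_bij; apply: injF_bij => i j [rij]; apply: vinj.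
by have [||//] := ltgtP (v 0 i) (v 0 j); rewrite -rank_lt rij ltnn.
Qed.

(** The indices run over 1..N-r-1 in the first sum, 1..r in the second and r+1..N+r in the third.
    The last two join to 1..N+r; the first cancels their beginning, and the remaining range N-r..N+r
    is symmetric about N, where [F] is antisymmetric. *)
Lemma sum_reflected (R : realType) (N r : nat) (F : nat -> R) :
  (r < N)%N -> (forall m, (m <= 2 * N)%N -> F (2 * N - m)%N = - F m) ->
  \sum_(0 <= k < N | (r < k)%N) F (k - r)%N
  - \sum_(0 <= k < N | (k < r)%N) F (r - k)%N
  - \sum_(0 <= k < N) F (k + r.+1)%N = 0.
Proof.
move=> rN Frefl.
have -> : \sum_(0 <= k < N | (r < k)%N) F (k - r)%N =
    \sum_(1 <= m < N - r) F m.
  transitivity (\sum_(r.+1 <= k < N) F (k - r)%N).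
    by rewrite (big_nat_widenl r.+1 0).
  rewrite -add1n big_addn.
  by apply: eq_bigr => m _; rewrite addnK.
have -> : \sum_(0 <= k < N | (k < r)%N) F (r - k)%N = \sum_(1 <= m < r.+1) F m.
  transitivity (\sum_(0 <= k < r) F (r - k)%N).
    by rewrite (big_nat_widen 0 r N)// ltnW.
  rewrite big_nat_rev big_add1/=; apply: eq_big_nat => m /andP[_ mr].
  by congr (F _); lia.
have -> : \sum_(0 <= k < N) F (k + r.+1)%N = \sum_(r.+1 <= m < N + r.+1) F m.
  by rewrite -{2}[r.+1]add0n big_addn addnK.
rewrite -addrA -opprD -big_cat_nat//=; last by lia.
rewrite (@big_cat_nat _ _ _ (N - r) 1 (N + r.+1))//=; [|lia|lia].
rewrite opprD addrA subrr add0r; apply/eqP; rewrite oppr_eq0; apply/eqP.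
set S := \sum_(_ <= _ < _) _.
suff : S = - S by lra.
rewrite {1}/S big_nat_rev/= -sumrN; apply: eq_big_nat => m /andP[m1 m2].
by rewrite -Frefl; [congr (F _); lia|lia].
Qed.

(* Together with their mirror images, these are 2N equispaced points on the
   circle R / 2Z. *)
Definition equidistributed (R : realType) (N : nat) (v0 : 'rV[R]_N) :
    'rV[R]_N :=
  \row_i (((rank v0 i)%:R + 2^-1) / N%:R).

Lemma equidistributed_admissible (R : realType) (N : nat) (v0 : 'rV[R]_N) :
  injective (fun i => v0 0 i) ->
  admissible (equidistributed v0) /\ same_order v0 (equidistributed v0).
Proof.
move=> v0inj.
have N_gt0 (i : 'I_N) : 0 < (N%:R : R).
  by rewrite ltr0n (leq_trans _ (rank_ltN v0 i)).
have ord : same_order v0 (equidistributed v0).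
  move=> i j; have {N_gt0}N0 := N_gt0 i.
  by rewrite !mxE ltr_pM2r ?invr_gt0// ltrD2r ltr_nat rank_lt.
split=> //; split=> [i|i j wij].
  have {N_gt0}N0 := N_gt0 i.
  have : (rank v0 i).+1%:R <= (N%:R : R) by rewrite ler_nat rank_ltN.
  rewrite -natr1 !mxE => rN; have r0 : 0 <= ((rank v0 i)%:R : R) by [].
  by apply/andP; split; [apply: divr_gt0|rewrite ltr_pdivrMr]; lra.
apply: v0inj; have := ord i j; have := ord j i; rewrite wij ltxx.
by have [] := ltgtP (v0 0 i) (v0 0 j).
Qed.

(** With rank k placed at (k + 1/2) / N, differences are (k - r) / N and sums (k + r + 1) / N. All
    forces are thus values of [F], and the reflection law of [G] becomes antisymmetry about [N]. *)
Lemma equidistributed_balanced (R : realType) (N : nat) (Psi G : R -> R)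
    (v0 : 'rV[R]_N) (i : 'I_N) :
  flux_extension Psi G -> injective (fun i => v0 0 i) ->
  ordered_velocity G v0 (equidistributed v0) i = 0.
Proof.
move=> hG v0inj; set r := rank v0 i; have rN : (r < N)%N := rank_ltN v0 i.
have N0 : (N%:R : R) != 0 by rewrite pnatr_eq0 -lt0n (leq_trans _ rN).
pose F m := G (m%:R / N%:R).
rewrite -[RHS](@sum_reflected _ N r F) => [|//|m mN]; last first.
  rewrite /F -(flux_ext_reflect hG) natrB// natrM mulrBl mulfK//.
rewrite /ordered_velocity; congr (_ - _ - _).
- rewrite -(@sum_rank _ _ v0 (fun k => r < k)%N (fun k => F (k - r)%N))//.
  apply: eq_big => [j|j]; rewrite -rank_lt// => ij.
  by rewrite !mxE /F natrB ?(ltnW ij)//; congr G; field.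
- rewrite -(@sum_rank _ _ v0 (fun k => k < r)%N (fun k => F (r - k)%N))//.
  apply: eq_big => [j|j]; rewrite -rank_lt// => ij.
  by rewrite !mxE /F natrB ?(ltnW ij)//; congr G; field.
- rewrite -(@sum_rank _ _ v0 xpredT (fun k => F (k + r.+1)%N))//.
  apply: eq_bigr => j _.
  by rewrite !mxE /F natrD -natr1; congr G; field.
Qed.

(** * Folding, sorting and global minimality *)

(** A sign change of [s] only swaps the two terms, and a shift by 2 fixes both. So [s] is made
    nonnegative, reduced modulo 2 and, if still beyond 1, reflected at 1. *)
Lemma penaliser_fold (R : realType) (Psi : R -> R) (s : R) : penaliser Psi ->
  exists s', 0 <= s' <= 1 /\ forall b,
    Psi ((s - b) ^+ 2) + Psi ((s + b) ^+ 2) =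
    Psi ((s' - b) ^+ 2) + Psi ((s' + b) ^+ 2).
Proof.
move=> hPsi; pose P a b := Psi ((a - b) ^+ 2) + Psi ((a + b) ^+ 2).
have PN a b : P (- a) b = P a b.
  by rewrite /P -opprD sqrrN addrC -[- a + b]opprK opprD opprK sqrrN.
have P2 a b : P (2 + a) b = P a b.
  rewrite /P -[2 + a - b]addrA -[2 + a + b]addrA.
  by rewrite !(penaliser_periodic hPsi).
have P2n n a b : P (2 * n%:R + a) b = P a b.
  elim: n => [|n IH]; first by rewrite mulr0 add0r.
  by rewrite -[n.+1%:R]natr1 mulrDr mulr1 [_ + 2]addrC -addrA P2.
pose n := Num.truncn (`|s| / 2).
have /andP[n1 n2] : n%:R <= `|s| / 2 < n.+1%:R.
  by apply: truncn_itv; rewrite divr_ge0.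
have Pabs b : P s b = P (`|s| - 2 * n%:R) b.
  rewrite -[in RHS](P2n n) addrC subrK.
  by case: (ger0P s) => _; rewrite ?PN.
rewrite -[n.+1%:R]natr1 in n2; have [r1|r1] := leP (`|s| - 2 * n%:R) 1.
  by exists (`|s| - 2 * n%:R); split; [lra|exact: Pabs].
exists (2 - (`|s| - 2 * n%:R)); split; first lra.
by move=> b; rewrite -!/(P _ _) P2 PN.
Qed.

(** Rearrangement argument: a permutation maximising the correlation [c] has no inversion. Swapping
    the images of [i] and [j] changes [c] by (u j - u i) (w (s i) - w (s j)), which therefore is not
    positive. *)
Lemma exists_sorting_perm (R : realType) (N : nat) (u w : 'I_N -> R) :
  exists s : 'S_N, forall i j, u i < u j -> w (s i) <= w (s j).
Proof.
pose c (s : 'S_N) := \sum_i u i * w (s i).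
have [s _ smax] := @arg_maxP _ _ _ 1%g xpredT c isT.
exists s => i j uij; have ij : i != j.
  by apply: contraTneq uij => ->; rewrite ltxx.
have cE t : c t = u i * w (t i) + (u j * w (t j) +
    \sum_(k | (k != i) && (k != j)) u k * w (t k)).
  by rewrite /c (bigD1 i)//= (bigD1 j)//= eq_sym.
have := smax (tperm i j * s)%g isT; rewrite /= !cE !permM tpermL tpermR.
rewrite (eq_bigr (fun k => u k * w (s k))) => [?|k /andP[ki kj]]; first nra.
by rewrite permM tpermD 1?eq_sym.
Qed.

Lemma energy_minimal (R : realType) (N : nat) (Psi G : R -> R)
    (v0 z : 'rV[R]_N) :
  penaliser Psi -> flux_extension Psi G -> injective (fun i => v0 0 i) ->
  weakly_ordered v0 z -> (forall i, ordered_velocity G v0 z i = 0) ->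
  global_minimiser (energy Psi (const_mx 1)) z.
Proof.
move=> hPsi hG v0inj zord z0 w.
pose P a b := Psi ((a - b) ^+ 2) + Psi ((a + b) ^+ 2).
have PC a b : P a b = P b a by rewrite /P -opprB sqrrN [a + b]addrC.
have energyE (x : 'rV[R]_N) : energy Psi (const_mx 1) x =
    2^-1 * \sum_i \sum_j P (x 0 j) (x 0 i).
  congr (_ * _); apply: eq_bigr => i _; apply: eq_bigr => j _.
  by rewrite mxE mul1r.
have [g gP] := choice (fun i => penaliser_fold (w 0 i) hPsi).
have gE i b : P (w 0 i) b = P (g i) b := (gP i).2 b.
have [s sP] := exists_sorting_perm (fun i => v0 0 i) g.
pose x : 'rV[R]_N := \row_i g (s i).
have -> : energy Psi (const_mx 1) w = energy Psi (const_mx 1) x.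
  rewrite !energyE; congr (_ * _).
  rewrite (reindex_inj (@perm_inj _ s)); apply: eq_bigr => i _.
  rewrite (reindex_inj (@perm_inj _ s)); apply: eq_bigr => j _.
  (* Folding acts on the first argument of [P]; the symmetry [PC] brings the second one there. *)
  by rewrite !mxE gE PC gE PC.
have [->//|xz] := eqVneq x z.
apply/ltW/(energy_lt hG (penaliser0 hPsi) v0inj zord _ z0 xz).
by split=> [i|i j /sP]; rewrite !mxE//; exact: (gP _).1.
Qed.

(** * Persistence of the order *)

(* At the first time where some [g i] vanishes its derivative is positive, so
   it was negative shortly before. *)
Lemma positive_forever (R : realType) (I : finType) (g h : I -> R -> R) :
  (forall i, continuous (g i)) -> (forall i, continuous (h i)) ->
  (forall i, 0 < g i 0) ->
  (forall t, 0 < t -> (forall i, 0 < g i t) ->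
     forall i, is_derive t 1 (g i) (h i t)) ->
  (forall t, (forall i, 0 <= g i t) -> forall i, g i t = 0 -> 0 < h i t) ->
  forall t i, 0 <= t -> 0 < g i t.
Proof.
move=> gc hc g0 gh hpos t1 i1 t10; rewrite ltNge; apply/negP => git1.
pose B := [set t | 0 <= t /\ exists i, g i t <= 0].
have Bt1 : B t1 by split=> //; exists i1.
have lbB : lbound B 0 by move=> t [].
have hiB : has_inf B by split; [exists t1|exists 0].
pose T := inf B.
have T0 : 0 <= T by apply: lb_le_inf => //; exists t1.
have before t : 0 <= t < T -> forall i, 0 < g i t.
  move=> /andP[t0 tT] i; rewrite ltNge; apply/negP => gi.
  have : T <= t by apply: ge_inf; [exists 0|split=> //; exists i].
  by rewrite leNgt tT.
(* Otherwise all functions would be positive on a ball around [T], yet [B] has points arbitrarily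
   close above its infimum. *)
have [i gi] : exists i, g i T <= 0.
  apply: contrapT => /forallNP gT.
  have nearT i : \forall t \near T, 0 < g i t.
    apply: (@cvgr_gt _ _ _ _ _ (g i T) (gc i T)).
    by rewrite ltNge; apply/negP; exact: gT.
  have /nbhs_ballP[e /= e0 eT] : \forall t \near T, forall i, 0 < g i t.
    exact: (@filter_forall _ _ _ (nbhs T) _ nearT).
  have [b [b0 [i gib]] bT] := inf_adherent e0 hiB.
  have Tb : T <= b by apply: ge_inf; [exists 0|split=> //; exists i].
  have : ball T e b by rewrite /ball/= distrC ger0_norm ?subr_ge0// ltrBlDl.
  by move=> /eT /(_ i); rewrite ltNge gib.
have {}T0 : 0 < T.
  by rewrite lt_neqAle T0 andbT; apply: contraTneq gi => <-; rewrite -ltNge.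
have near_left e : 0 < e -> exists2 s, 0 < s < T & T - s < e.
  move=> e0; have [m1 m2] : Num.min (e / 2) (T / 2) <= e / 2 /\
      Num.min (e / 2) (T / 2) <= T / 2 by rewrite !ge_min !lexx orbT.
  have m0 : 0 < Num.min (e / 2) (T / 2) by rewrite lt_min; apply/andP; lra.
  by exists (T - Num.min (e / 2) (T / 2)); lra.
have gT j : 0 <= g j T.
  rewrite leNgt; apply/negP => gj.
  have /nbhs_ballP[e /= e0 eT] : \forall t \near T, g j t < 0.
    exact: (@cvgr_lt _ _ _ _ _ (g j T) (gc j T)).
  have [s /andP[s0 sT] Ts] := near_left e e0.
  have /eT : ball T e s by rewrite /ball/= gtr0_norm// subr_gt0.
  by rewrite ltNge ltW// before// ltW//=.
have giT : g i T = 0 by apply/eqP; rewrite eq_le gi gT.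
have hiT := hpos T gT i giT.
have /nbhs_ballP[e /= e0 eT] : \forall t \near T, 0 < h i t.
  exact: (@cvgr_gt _ _ _ _ _ (h i T) (hc i T)).
have [s /andP[s0 sT] Ts] := near_left e e0.
(* The derivative is known only while everything is positive, hence before [T]. Continuity carries
   the sign of [h i T] to the left, and the mean value theorem contradicts [g i T = 0 < g i s]. *)
have [t|//|c] := @MVT _ (g i) (h i) s T sT.
- rewrite in_itv/= => /andP[st tT]; have t0 : 0 < t by lra.
  by apply: gh => // j; apply: before; lra.
- exact/continuous_subspaceT/gc.
rewrite in_itv/= => /andP[sc cT].
have gs : 0 < g i s by apply: before; lra.
have /eT hc0 : ball T e c by rewrite /ball/= gtr0_norm ?subr_gt0//; lra.
by rewrite giT; nra.
Qed.

Lemma sumr_gt0_at (R : realType) (I : finType) (k : I) (F : I -> R) :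
  (forall i, 0 <= F i) -> 0 < F k -> 0 < \sum_i F i.
Proof.
by move=> F0 Fk; rewrite (bigD1 k)//= ltr_wpDr// sumr_ge0.
Qed.

Lemma ordered_velocityE (R : realType) (N : nat) (G : R -> R)
    (v0 x : 'rV[R]_N) (i : 'I_N) :
  ordered_velocity G v0 x i =
  \sum_k ((if v0 0 i < v0 0 k then G (x 0 k - x 0 i) else 0)
          - (if v0 0 k < v0 0 i then G (x 0 i - x 0 k) else 0)
          - G (x 0 k + x 0 i)).
Proof. by rewrite /ordered_velocity !sumrB -!big_mkcond. Qed.

(** Mirror images and particles outside the pair in the order act equally on both. Particles ranked
    in between sit at the same point and, like [i] and [j] themselves, push the two apart because
    [G 0 < 0]. *)
Lemma ordered_velocity_collision (R : realType) (N : nat) (Psi G : R -> R)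
    (v0 x : 'rV[R]_N) (i j : 'I_N) :
  flux_extension Psi G -> injective (fun i => v0 0 i) -> weakly_ordered v0 x ->
  v0 0 i < v0 0 j -> x 0 i = x 0 j ->
  ordered_velocity G v0 x i < ordered_velocity G v0 x j.
Proof.
move=> hG v0inj [x01 xord] ij xij; have G0 := flux_ext0_lt0 hG.
rewrite -subr_gt0 !ordered_velocityE -sumrB.
apply: (sumr_gt0_at (k := i)) => [k|]; last first.
  by rewrite ltxx ij (lt_gtF ij) xij !subrr; lra.
rewrite xij; have [ik|ki|/v0inj <-] := ltgtP (v0 0 i) (v0 0 k); last first.
- by rewrite ij (lt_gtF ij) xij !subrr; lra.
- by rewrite (lt_gtF (lt_trans ki ij)) (lt_trans ki ij); lra.
have [jk|kj|/v0inj <-] := ltgtP (v0 0 j) (v0 0 k); first by lra.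
- have -> : x 0 k = x 0 j.
    by apply/eqP; rewrite eq_le (xord _ _ kj) -xij xord.
  by rewrite [x 0 j - _]subrr; lra.
- by rewrite [x 0 j - _]subrr; lra.
Qed.

(** A particle ranked above [i] cancels against its mirror image; one ranked below also sits at 0.
    The mirror image of [i], in contact with it, pushes upwards by [- G 0]. *)
Lemma ordered_velocity_bottom (R : realType) (N : nat) (Psi G : R -> R)
    (v0 x : 'rV[R]_N) (i : 'I_N) :
  flux_extension Psi G -> injective (fun i => v0 0 i) -> weakly_ordered v0 x ->
  x 0 i = 0 -> 0 < ordered_velocity G v0 x i.
Proof.
move=> hG v0inj [x01 xord] xi; have G0 := flux_ext0_lt0 hG.
rewrite ordered_velocityE; apply: (sumr_gt0_at (k := i)) => [k|]; last first.
  by rewrite ltxx xi addr0; lra.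
rewrite xi; have [ik|ki|/v0inj <-] := ltgtP (v0 0 i) (v0 0 k).
- by rewrite [x 0 k - 0]subr0 addr0; lra.
- have -> : x 0 k = 0.
    by apply/eqP; rewrite eq_le -{1}xi (xord _ _ ki); have /andP[] := x01 k.
  by rewrite subrr addr0; lra.
- by rewrite xi addr0; lra.
Qed.

(** The same cancellation at 1, which the circle identifies with the mirror point -1; contact there
    means distance 2, with [G 2 = - G 0]. *)
Lemma ordered_velocity_top (R : realType) (N : nat) (Psi G : R -> R)
    (v0 x : 'rV[R]_N) (i : 'I_N) :
  flux_extension Psi G -> injective (fun i => v0 0 i) -> weakly_ordered v0 x ->
  x 0 i = 1 -> ordered_velocity G v0 x i < 0.
Proof.
move=> hG v0inj [x01 xord] xi; have G0 := flux_ext0_lt0 hG.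
have G2 : G (1 + 1) = - G 0.
  by rewrite -(flux_ext_reflect hG) subr0.
rewrite -oppr_gt0 ordered_velocityE -sumrN.
apply: (sumr_gt0_at (k := i)) => [k|]; last first.
  by rewrite ltxx xi G2; lra.
rewrite xi; have [ik|ki|/v0inj <-] := ltgtP (v0 0 i) (v0 0 k).
- have -> : x 0 k = 1.
    apply/eqP; rewrite eq_le -{2}xi (xord _ _ ik) andbT.
    by have /andP[] := x01 k.
  by rewrite subrr G2; lra.
- have -> : x 0 k + 1 = 2 - (1 - x 0 k) by ring.
  by rewrite (flux_ext_reflect hG); lra.
- by rewrite xi G2; lra.
Qed.

Lemma continuous_ordered_velocity (R : realType) (N : nat) (Psi G : R -> R)
    (v0 : 'rV[R]_N) (x : R -> 'rV[R]_N) (i : 'I_N) :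
  flux_extension Psi G -> (forall i, continuous (fun t => x t 0 i)) ->
  continuous (fun t => ordered_velocity G v0 (x t) i).
Proof.
move=> hG xc t.
have Gc (f : R -> R) : continuous f -> G (f s) @[s --> t] --> G (f t).
  move=> fc; apply: (@cvg_comp _ _ _ f G); first exact: fc.
  exact: flux_ext_continuous hG _.
apply: cvgB; first apply: cvgB.
- apply: (cvg_big add_continuous) => j _.
  apply: (Gc (fun s => x s 0 j - x s 0 i)) => s.
  by apply: cvgB; exact: xc.
- apply: (cvg_big add_continuous) => j _.
  apply: (Gc (fun s => x s 0 i - x s 0 j)) => s.
  by apply: cvgB; exact: xc.
- apply: (cvg_big add_continuous) => j _.
  apply: (Gc (fun s => x s 0 j + x s 0 i)) => s.
  by apply: cvgD; exact: xc.
Qed.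

Lemma order_preserved (R : realType) (N : nat) (Psi G : R -> R)
    (v0 : 'rV[R]_N) (x : R -> 'rV[R]_N) :
  flux_extension Psi G -> admissible v0 -> x 0 = v0 ->
  (forall i, continuous (fun t => x t 0 i)) ->
  (forall (t : R) i, 0 < t -> is_derive t 1 (fun s => x s 0 i)
     (velocity Psi (const_mx 1) (x t) i)) ->
  forall t, 0 <= t -> admissible (x t) /\ same_order v0 (x t).
Proof.
move=> hG [v001 v0inj] x0 xc xd.
pose I : finType := (('I_N * 'I_N) + ('I_N + 'I_N))%type.
(* The gaps are constantly 1 on the pairs (i, j) that are not in order. *)
pose g (k : I) (t : R) : R := match k with
  | inl (i, j) => if v0 0 i < v0 0 j then x t 0 j - x t 0 i else 1
  | inr (inl i) => x t 0 i
  | inr (inr i) => 1 - x t 0 i end.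
pose F i t := ordered_velocity G v0 (x t) i.
pose h (k : I) (t : R) : R := match k with
  | inl (i, j) => if v0 0 i < v0 0 j then F j t - F i t else 0
  | inr (inl i) => F i t
  | inr (inr i) => - F i t end.
have g_adm (t : R) : (forall k, 0 < g k t) ->
    admissible (x t) /\ same_order v0 (x t).
  move=> gt.
  have up i j : v0 0 i < v0 0 j -> x t 0 i < x t 0 j.
    by move=> ij; have := gt (inl (i, j)); rewrite /g ij subr_gt0.
  have ord : same_order v0 (x t).
    move=> i j; have [ij|ji|/v0inj <-] := ltgtP (v0 0 i) (v0 0 j).
    - by rewrite up.
    - by rewrite (lt_gtF (up _ _ ji)).
    - by rewrite ltxx.
  split=> //; split=> [i|i j xij].
    by have := gt (inr (inl i)); have := gt (inr (inr i)); rewrite /g; lra.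
  apply: v0inj; have := ord i j; have := ord j i; rewrite xij ltxx.
  by have [] := ltgtP (v0 0 i) (v0 0 j).
have g_weak (t : R) : (forall k, 0 <= g k t) -> weakly_ordered v0 (x t).
  move=> gt; split=> [i|i j ij].
    by have := gt (inr (inl i)); have := gt (inr (inr i)); rewrite /g; lra.
  by have := gt (inl (i, j)); rewrite /g ij subr_ge0.
have Fc i : continuous (F i) by exact: continuous_ordered_velocity hG xc.
move=> t t0; apply: (g_adm) => k; apply: (@positive_forever _ _ g h) => //.
- move=> [[i j]|[i|i]] s; rewrite /g/=.
  + case: (v0 0 i < v0 0 j); last exact: cvg_cst.
    by apply: cvgB; exact: xc.
  + exact: xc.
  + by apply: cvgB; [exact: cvg_cst|exact: xc].
- move=> [[i j]|[i|i]] s; rewrite /h/=.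
  + case: (v0 0 i < v0 0 j); last exact: cvg_cst.
    by apply: cvgB; exact: Fc.
  + exact: Fc.
  + by apply: cvgN; exact: Fc.
- move=> [[i j]|[i|i]]; rewrite /g x0; last 2 first.
  + by have /andP[] := v001 i.
  + by have /andP[] := v001 i; rewrite subr_gt0.
  + by case: ifP; rewrite ?subr_gt0.
- move=> s s0 /g_adm[xadm xord].
  (* [velocity] and the continuous [F] agree only while the order persists, which is just when the
     derivative is required. *)
  have xd' i : is_derive s 1 (fun s => x s 0 i) (F i s).
    by rewrite /F -(velocity_ordered _ hG xadm xord); exact: xd.
  move=> [[i j]|[i|i]]; rewrite /g/h/=.
  + case: (v0 0 i < v0 0 j); last exact: is_derive_cst.
    exact: is_deriveB.
  + exact: xd'.
  + by rewrite -[X in is_derive _ _ _ X]add0r; exact: is_deriveB.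
- move=> s /g_weak xw [[i j]|[i|i]]; rewrite /g/h.
  + case: ifP => [ij /eqP|_ /eqP]; last by rewrite oner_eq0.
    rewrite subr_eq0 => /eqP xji; rewrite subr_gt0.
    exact: (ordered_velocity_collision hG).
  + exact: ordered_velocity_bottom hG v0inj xw.
  + move=> /eqP; rewrite subr_eq0 eq_sym oppr_gt0 => /eqP.
    exact: ordered_velocity_top hG v0inj xw.
Qed.

(** * The squared distance as a Lyapunov function *)

Lemma flux_ext_gap (R : realType) (Psi G : R -> R) (z e : R) :
  flux_extension Psi G -> 0 < z < 1 -> 0 < e ->
  exists2 c, 0 < c & forall a, e <= `|a - z| ->
    c <= (G (2 * a) - G (2 * z)) * (a - z).
Proof.
(* The radius keeps [2 * (z - r)] and [2 * (z + r)] in [0, 2], where [G] is strictly increasing;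
   points farther out are handled by weak monotonicity. *)
move=> hG z01 e0; pose r := Num.min e (Num.min z (1 - z)).
have [re rz r1z] : [/\ r <= e, r <= z & r <= 1 - z].
  by rewrite /r !ge_min !lexx !orbT.
have r0 : 0 < r by rewrite !lt_min e0/=; lra.
have up : 0 < G (2 * (z + r)) - G (2 * z).
  by rewrite subr_gt0; apply: (flux_ext_lt hG); rewrite ?in_itv/=; lra.
have down : 0 < G (2 * z) - G (2 * (z - r)).
  by rewrite subr_gt0; apply: (flux_ext_lt hG); rewrite ?in_itv/=; lra.
pose c := Num.min (G (2 * (z + r)) - G (2 * z)) (G (2 * z) - G (2 * (z - r))).
have c0 : 0 < c by rewrite lt_min up.
have [cu cd] : c <= G (2 * (z + r)) - G (2 * z) /\
    c <= G (2 * z) - G (2 * (z - r)) by rewrite !ge_min !lexx orbT.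
exists (c * r); first exact: mulr_gt0.
move=> a; rewrite real_ler_normr ?num_real// => /orP[az|az].
  have Ga : G (2 * (z + r)) <= G (2 * a) by apply: (flux_ext_homo hG); lra.
  by apply: ler_pM; lra.
have Ga : G (2 * a) <= G (2 * (z - r)) by apply: (flux_ext_homo hG); lra.
by rewrite -[leRHS]mulrNN; apply: ler_pM; lra.
Qed.

Lemma flux_ext_uniform_gap (R : realType) (N : nat) (Psi G : R -> R)
    (z : 'rV[R]_N) (e : R) :
  flux_extension Psi G -> (forall i, 0 < z 0 i < 1) -> 0 < e ->
  exists2 c, 0 < c & forall i a, e <= `|a - z 0 i| ->
    c <= (G (2 * a) - G (2 * z 0 i)) * (a - z 0 i).
Proof.
move=> hG z01 e0.
have /choice[c cP] i : exists c, 0 < c /\ forall a, e <= `|a - z 0 i| ->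
    c <= (G (2 * a) - G (2 * z 0 i)) * (a - z 0 i).
  by have [c] := flux_ext_gap hG (z01 i) e0; exists c.
(* The seed 1 keeps the minimum positive when [N = 0]. *)
exists (\big[Num.min/1]_i c i).
  by apply: lt_bigmin => // i _; have [] := cP i.
move=> i a /(proj2 (cP i)); apply: le_trans; exact: bigmin_le.
Qed.

(** While some coordinate is at least [eta] away, [D] falls at a rate of at least [c]. Since [D] is
    nonnegative, all coordinates are [eta]-close at some time, and afterwards [D] cannot grow. *)
Lemma converges_to_balanced (R : realType) (N : nat) (Psi G : R -> R)
    (v0 z : 'rV[R]_N) (x : R -> 'rV[R]_N) :
  flux_extension Psi G -> (forall i, 0 < z 0 i < 1) ->
  (forall i, ordered_velocity G v0 z i = 0) ->
  (forall i, continuous (fun t => x t 0 i)) ->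
  (forall (t : R) i, 0 < t ->
     is_derive t 1 (fun s => x s 0 i) (ordered_velocity G v0 (x t) i)) ->
  forall e, 0 < e -> \forall t \near +oo, forall i, `|x t 0 i - z 0 i| < e.
Proof.
move=> hG z01 z0 xc xd e e0.
pose D (t : R) := \sum_i (x t 0 i - z 0 i) ^+ 2.
pose dD (t : R) := 2 * \sum_i (x t 0 i - z 0 i) * ordered_velocity G v0 (x t) i.
have Dder (t : R) : 0 < t -> is_derive t 1 D (dD t).
  move=> t0; rewrite /dD mulr_sumr.
  have -> : D = \sum_i ((fun t => x t 0 i) - cst (z 0 i)) ^+ 2.
    by apply/funext => s; rewrite fct_sumE.
  apply: is_derive_sum => i.
  have xz : is_derive t 1 ((fun t => x t 0 i) - cst (z 0 i))
      (ordered_velocity G v0 (x t) i).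
    have := is_deriveB (xd t i t0) (is_derive_cst (z 0 i) t 1).
    by rewrite subr0.
  by rewrite mulrA; exact: is_deriveX xz.
have Dc : continuous D.
  move=> t; apply: (cvg_big add_continuous) => i _.
  by rewrite expr2; apply: cvgM; (apply: cvgB; [exact: xc|exact: cvg_cst]).
have D0 (t : R) : 0 <= D t by apply: sumr_ge0 => i _; exact: sqr_ge0.
have dD_le (t : R) k : dD t <=
    - (2 * ((G (2 * x t 0 k) - G (2 * z 0 k)) * (x t 0 k - z 0 k))).
  rewrite /dD -mulrN ler_pM2l//.
  have := ordered_velocity_monotone v0 (x t) z k hG.
  by under eq_bigr do rewrite z0 subr0.
have MVT_D (s t : R) : 0 < s -> s < t ->
    exists2 c, s < c < t & D t - D s = dD c * (t - s).
  move=> s0 st; have [u|//|c] := @MVT _ D dD s t st.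
  - by rewrite in_itv/= => /andP[su _]; apply: Dder; exact: lt_trans su.
  - exact: continuous_subspaceT.
  - by rewrite in_itv/=; exists c.
have D_noninc (s t : R) : 0 < s -> s <= t -> D t <= D s.
  move=> s0; rewrite le_eqVlt => /orP[/eqP->//|st].
  have [c _ Dst] := MVT_D s t s0 st.
  have dDc : dD c <= 0.
    case: (posnP N) => [N0|N0].
      rewrite /dD big1 ?mulr0// => i _; have := ltn_ord i.
      by rewrite {2}N0.
    apply: (le_trans (dD_le c (Ordinal N0))); rewrite oppr_le0 mulr_ge0//.
    have := flux_ext_mono (2 * x c 0 (Ordinal N0)) (2 * z 0 (Ordinal N0)) hG.
    lra.
  by nra.
(* Chosen so that [N%:R * eta ^+ 2 < e ^+ 2], also for [N = 0]. *)
pose eta := e / N.+1%:R.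
have eta0 : 0 < eta by rewrite divr_gt0.
have [c c0 cP] := flux_ext_uniform_gap hG z01 eta0.
have [t0 t01 close] : exists2 t0, 0 < t0 & forall k, `|x t0 0 k - z 0 k| < eta.
  apply: contrapT => far.
  (* A waiting time after which [D], falling at rate [c], would be negative: [c * M = D 1 + c]. It
     starts at 1 because derivatives are given at positive times only. *)
  pose M := D 1 / c + 1.
  have M0 : 0 < M by rewrite ltr_wpDl// divr_ge0// ltW.
  have [|u /andP[u1 _] Du] := @MVT_D 1 (1 + M) ltr01; first by rewrite ltrDl.
  have dDu : dD u <= - c.
    apply: contrapT => /negP; rewrite -ltNge => dDu.
    apply: far; exists u; first lra.
    move=> k; rewrite ltNge; apply/negP => /cP; have := dD_le u k; lra.
  have McD : c * M = D 1 + c by rewrite /M; field; exact: lt0r_neq0.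
  have := D0 (1 + M); nra.
near=> t => i.
have t0t : t0 <= t by near: t; apply: nbhs_pinfty_ge; exact: num_real.
have Dt0 : D t0 <= N%:R * eta ^+ 2.
  rewrite -[N in N%:R]card_ord -sum1_card natr_sum mulr_suml.
  apply: ler_sum => k _; rewrite mul1r; have := close k; rewrite ltr_norml; nra.
have xi : (x t 0 i - z 0 i) ^+ 2 <= D t.
  by rewrite /D (bigD1 i)//= lerDl sumr_ge0// => k _; exact: sqr_ge0.
have Neta : N%:R * eta ^+ 2 < e ^+ 2.
  have -> : e = N.+1%:R * eta by rewrite /eta mulrC divfK// pnatr_eq0.
  rewrite [(_ * eta) ^+ 2]exprMn ltr_pM2r ?exprn_gt0//.
  have NN : 0 <= (N%:R : R) by [].
  by rewrite -[N.+1%:R]natr1; nra.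
rewrite -[_ < e]ltr_sqr ?nnegrE ?(ltW e0)// real_normK ?num_real//.
apply: le_lt_trans xi _; apply: le_lt_trans (D_noninc t0 t _ _) _ => //.
exact: le_lt_trans Neta.
Unshelve. all: by end_near. Qed.

Lemma evolution_converges (R : realType) (N : nat) (Psi G : R -> R)
    (v0 z : 'rV[R]_N) (v : R -> 'rV[R]_N) :
  flux_extension Psi G -> admissible v0 -> (forall i, 0 < z 0 i < 1) ->
  (forall i, ordered_velocity G v0 z i = 0) ->
  evolution Psi (const_mx 1) v0 v -> v t @[t --> +oo] --> z.
Proof.
move=> hG v0adm z01 z0 [vinit vc vd].
(* Freezing [v] at its initial value for negative times gives a path continuous on the whole
   line. *)
pose x (t : R) := v (Num.max 0 t).
have xE (t : R) : 0 <= t -> x t = v t by move=> t0; rewrite /x (max_idPr t0).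
have x_cont : continuous x.
  apply: (continuous_retract vc) => [|t].
    by apply: (@max_fun_continuous _ R R (cst 0) id) => t;
      [exact: cvg_cst|exact: cvg_id].
  by rewrite /= in_itv/= le_max lexx.
have xc i : continuous (fun t => x t 0 i).
  move=> t; apply: (@cvg_comp _ _ _ x (fun A : 'rV[R]_N => A 0 i)).
    exact: x_cont.
  exact: coord_continuous.
have xd (t : R) i : 0 < t ->
    is_derive t 1 (fun s => x s 0 i) (velocity Psi (const_mx 1) (x t) i).
  move=> t0; rewrite (xE _ (ltW t0)); apply: near_eq_is_derive (vd t i t0).
  by near=> s; rewrite xE// ltW//; near: s; exact: lt_nbhsr.
have x0 : x 0 = v0 by rewrite xE.
have adm := order_preserved hG v0adm x0 xc xd.
have xd' (t : R) i : 0 < t ->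
    is_derive t 1 (fun s => x s 0 i) (ordered_velocity G v0 (x t) i).
  move=> t0; have [xadm xord] := adm t (ltW t0).
  by rewrite -(velocity_ordered _ hG xadm xord); exact: xd.
apply/cvg_ballP => e e0; near=> t; split=> // i j.
rewrite (ord1 i) /ball/= distrC -xE; last first.
  by near: t; apply: nbhs_pinfty_ge; exact: num_real.
move: j; near: t; exact: converges_to_balanced hG z01 z0 xc xd' e e0.
Unshelve. all: by end_near. Qed.

Theorem theorem7 (R : realType) (N : nat) (Psi : R -> R) (W : 'M[R]_N)
    (hPsi : penaliser Psi) (hW : W = const_mx 1)
    (v0 : 'rV[R]_N) (hv0 : admissible v0) :
  exists vstar : 'rV[R]_N,
    [/\ admissible vstar /\ same_order v0 vstar,
        forall v : R -> 'rV[R]_N, evolution Psi W v0 v ->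
          v t @[t --> +oo] --> vstar,
        steady_state Psi W vstar /\
          (forall w, admissible w -> same_order v0 w ->
             steady_state Psi W w -> w = vstar) &
        global_minimiser (energy Psi W) vstar /\
          (forall w, admissible w -> same_order v0 w ->
             global_minimiser (energy Psi W) w -> w = vstar)].
Proof.
subst W; have [G hG] := penaliser_flux_extension hPsi.
have v0inj := hv0.2; pose z := equidistributed v0.
have [zadm zord] := equidistributed_admissible v0inj.
have z0 i : ordered_velocity G v0 z i = 0.
  exact: equidistributed_balanced hG v0inj.
have zw := admissible_weakly_ordered zadm zord.
have Psi0 := penaliser0 hPsi.
exists z; split; [by []| |split|split].
- by move=> v; apply: evolution_converges hG hv0 _ z0; exact: zadm.1.
- by move=> i; rewrite (velocity_ordered _ hG zadm zord).
- move=> w wadm word w0.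
  have ww := admissible_weakly_ordered wadm word.
  have {}w0 i : ordered_velocity G v0 w i = 0.
    by rewrite -(velocity_ordered _ hG wadm word).
  (* Two distinct balanced configurations in this order would each have strictly less energy than
     the other. *)
  apply/eqP; apply: contraT => wz.
  have zltw := energy_lt hG Psi0 v0inj zw ww z0 wz.
  have := energy_lt hG Psi0 v0inj ww zw w0; rewrite eq_sym => /(_ wz).
  by rewrite (lt_gtF zltw).
- exact: energy_minimal hPsi hG v0inj zw z0.
- move=> w wadm word wmin.
  have ww := admissible_weakly_ordered wadm word.
  apply/eqP; apply: contraT => wz.
  have := energy_lt hG Psi0 v0inj zw ww z0 wz.
  by rewrite ltNge wmin.
Qed.
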